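(* If a logic $L$ has the uniform Lyndon interpolation property, then it has both the Lyndon interpolation property and the uniform interpolation property.
   Context: Formulas are built from atoms, $\bot$, $\wedge,\vee,\to$ and $\Box$; $\top$ abbreviates $\bot\to\bot$. A logic is a set $L$ of such formulas containing all intuitionistic propositional tautologies and closed under substitution and modus ponens; $L\vdash\phi$ means $\phi\in L$. Positive/negative variables: $V^+(p)=\{p\}$, $V^-(p)=\varnothing$ for atoms $p$; $V^{\pm}(\bot)=V^{\pm}(\top)=\varnothing$; $V^{\pm}(\phi\wedge\psi)=V^{\pm}(\phi\vee\psi)=V^{\pm}(\phi)\cup V^{\pm}(\psi)$; $V^+(\phi\to\psi)=V^-(\phi)\cup V^+(\psi)$, $V^-(\phi\to\psi)=V^+(\phi)\cup V^-(\psi)$; $V^{\pm}(\Box\phi)=V^{\pm}(\phi)$; $V(\phi)=V^+(\phi)\cup V^-(\phi)$. A formula is $p^{\circ}$-free if $p\notin V^{\circ}(\phi)$, and $p$-free if $p\notin V(\phi)$. ULIP: for every formula $\phi$, atom $p$ and $\circ\in\{+,-\}$ there are $p^{\circ}$-free formulas $\exists^{\circ}p\,\phi$, $\forall^{\circ}p\,\phi$ with $V^{\dagger}(\exists^{\circ}p\,\phi)\subseteq V^{\dagger}(\phi)$ and $V^{\dagger}(\forall^{\circ}p\,\phi)\subseteq V^{\dagger}(\phi)$ for all $\dagger\in\{+,-\}$, such that $L\vdash\phi\to\exists^{\circ}p\,\phi$; for every $p^{\circ}$-free $\psi$, $L\vdash\phi\to\psi$ implies $L\vdash\exists^{\circ}p\,\phi\to\psi$;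 $L\vdash\forall^{\circ}p\,\phi\to\phi$; for every $p^{\circ}$-free $\psi$, $L\vdash\psi\to\phi$ implies $L\vdash\psi\to\forall^{\circ}p\,\phi$. UIP: for every $\phi$ and atom $p$ there are $p$-free formulas $\exists p\,\phi,\forall p\,\phi$ with $V(\exists p\,\phi)\subseteq V(\phi)$, $V(\forall p\,\phi)\subseteq V(\phi)$, such that $L\vdash\phi\to\exists p\,\phi$; for every $p$-free $\psi$, $L\vdash\phi\to\psi$ implies $L\vdash\exists p\,\phi\to\psi$; $L\vdash\forall p\,\phi\to\phi$; for every $p$-free $\psi$, $L\vdash\psi\to\phi$ implies $L\vdash\psi\to\forall p\,\phi$. LIP: whenever $L\vdash\phi\to\psi$ there is $\theta$ with $V^{\dagger}(\theta)\subseteq V^{\dagger}(\phi)\cap V^{\dagger}(\psi)$ for all $\dagger\in\{+,-\}$, $L\vdash\phi\to\theta$ and $L\vdash\theta\to\psi$. *)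

(* Defs.v *)
From Stdlib Require Export List Ensembles.
Export ListNotations.

Set Implicit Arguments.

Inductive form (Atom : Type) : Type :=
| Var (p : Atom)
| Bot
| And (phi psi : form Atom)
| Or (phi psi : form Atom)
| Imp (phi psi : form Atom)
| Box (phi : form Atom).

Arguments Bot {Atom}.

Declare Scope form_scope.
Delimit Scope form_scope with form.
Bind Scope form_scope with form.
Notation "⊥" := Bot : form_scope.
Notation "a ∧ b" := (And a b) (at level 40, left associativity) : form_scope.
Notation "a ∨ b" := (Or a b) (at level 50, left associativity) : form_scope.
Notation "a ⟶ b" := (Imp a b) (at level 55, right associativity) : form_scope.
Notation "□ a" := (Box a) (at level 30, right associativity) : form_scope.
Local Open Scope form_scope.

Fixpoint subst {Atom : Type} (s : Atom -> form Atom) (phi : form Atom)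
  : form Atom :=
  match phi with
  | Var p => s p
  | ⊥ => ⊥
  | a ∧ b => subst s a ∧ subst s b
  | a ∨ b => subst s a ∨ subst s b
  | a ⟶ b => subst s a ⟶ subst s b
  | □ a => □ (subst s a)
  end.

(* Natural deduction for intuitionistic propositional logic. There is no rule
   for [Box], so boxed formulas behave as atoms: the theorems are exactly the
   substitution instances of the propositional intuitionistic tautologies. *)
Inductive ipc {Atom : Type} : list (form Atom) -> form Atom -> Prop :=
| ipc_ax G a : List.In a G -> ipc G a
| ipc_botE G a : ipc G ⊥ -> ipc G a
| ipc_andI G a b : ipc G a -> ipc G b -> ipc G (a ∧ b)
| ipc_andE1 G a b : ipc G (a ∧ b) -> ipc G a
| ipc_andE2 G a b : ipc G (a ∧ b) -> ipc G b
| ipc_orI1 G a b : ipc G a -> ipc G (a ∨ b)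
| ipc_orI2 G a b : ipc G b -> ipc G (a ∨ b)
| ipc_orE G a b c :
    ipc G (a ∨ b) -> ipc (a :: G) c -> ipc (b :: G) c -> ipc G c
| ipc_impI G a b : ipc (a :: G) b -> ipc G (a ⟶ b)
| ipc_impE G a b : ipc G (a ⟶ b) -> ipc G a -> ipc G b.

Notation "L ⊢ phi" := (Ensembles.In _ L phi%form) (at level 70, no associativity).

Record is_logic {Atom : Type} (L : Ensemble (form Atom)) : Prop := {
  logic_ipc : forall phi, ipc [] phi -> L ⊢ phi;
  logic_subst : forall s phi, L ⊢ phi -> L ⊢ subst s phi;
  logic_mp : forall phi psi, L ⊢ phi ⟶ psi -> L ⊢ phi -> L ⊢ psi
}.

Inductive sign : Set := Pos | Neg.

Definition opp (o : sign) : sign :=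
  match o with Pos => Neg | Neg => Pos end.

Fixpoint Vs {Atom : Type} (o : sign) (phi : form Atom) : Ensemble Atom :=
  match phi with
  | Var p => match o with Pos => Singleton _ p | Neg => Empty_set _ end
  | ⊥ => Empty_set _
  | a ∧ b | a ∨ b => Union _ (Vs o a) (Vs o b)
  | a ⟶ b => Union _ (Vs (opp o) a) (Vs o b)
  | □ a => Vs o a
  end.

Definition V {Atom : Type} (phi : form Atom) : Ensemble Atom :=
  Union _ (Vs Pos phi) (Vs Neg phi).

Definition sfree {Atom : Type} (o : sign) (p : Atom) (phi : form Atom) : Prop :=
  ~ Ensembles.In _ (Vs o phi) p.

Definition free {Atom : Type} (p : Atom) (phi : form Atom) : Prop :=
  ~ Ensembles.In _ (V phi) p.

Definition ULIP {Atom : Type} (L : Ensemble (form Atom)) : Prop :=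
  forall (phi : form Atom) (p : Atom) (o : sign),
  exists ex all : form Atom,
    sfree o p ex /\ sfree o p all /\
    (forall d : sign, Included _ (Vs d ex) (Vs d phi)) /\
    (forall d : sign, Included _ (Vs d all) (Vs d phi)) /\
    L ⊢ phi ⟶ ex /\
    (forall psi, sfree o p psi -> L ⊢ phi ⟶ psi -> L ⊢ ex ⟶ psi) /\
    L ⊢ all ⟶ phi /\
    (forall psi, sfree o p psi -> L ⊢ psi ⟶ phi -> L ⊢ psi ⟶ all).

Definition UIP {Atom : Type} (L : Ensemble (form Atom)) : Prop :=
  forall (phi : form Atom) (p : Atom),
  exists ex all : form Atom,
    free p ex /\ free p all /\
    Included _ (V ex) (V phi) /\
    Included _ (V all) (V phi) /\
    L ⊢ phi ⟶ ex /\
    (forall psi, free p psi -> L ⊢ phi ⟶ psi -> L ⊢ ex ⟶ psi) /\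
    L ⊢ all ⟶ phi /\
    (forall psi, free p psi -> L ⊢ psi ⟶ phi -> L ⊢ psi ⟶ all).

Definition LIP {Atom : Type} (L : Ensemble (form Atom)) : Prop :=
  forall phi psi : form Atom,
  L ⊢ phi ⟶ psi ->
  exists theta : form Atom,
    (forall d : sign,
       Included _ (Vs d theta) (Intersection _ (Vs d phi) (Vs d psi))) /\
    L ⊢ phi ⟶ theta /\
    L ⊢ theta ⟶ psi.

(* Main.v *)
(** A Lyndon interpolant of [phi ⟶ psi] is obtained from [phi] by eliminating,
    one after the other, the finitely many signed atoms of [phi] that do not
    occur in [psi]: [psi] is free of each of them, so it still follows from
    the result. The uniform interpolants are [∃⁻p ∃⁺p phi] and
    [∀⁻p ∀⁺p phi]. *)
Require Import Defs.
From Stdlib Require Classical_Prop.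

Lemma logic_trans (Atom : Type) (L : Ensemble (form Atom)) (hL : is_logic L)
  (a b c : form Atom) : L ⊢ Imp a b -> L ⊢ Imp b c -> L ⊢ Imp a c.
Proof.
  intros Hab Hbc.
  apply (logic_mp hL) with (2 := Hbc), (logic_mp hL) with (2 := Hab).
  apply (logic_ipc hL).
  do 3 apply ipc_impI.
  apply ipc_impE with b; [apply ipc_ax; simpl; tauto|].
  apply ipc_impE with a; apply ipc_ax; simpl; tauto.
Qed.

Lemma logic_refl (Atom : Type) (L : Ensemble (form Atom)) (hL : is_logic L)
  (a : form Atom) : L ⊢ Imp a a.
Proof. apply (logic_ipc hL), ipc_impI, ipc_ax; simpl; tauto. Qed.

(** A list rather than an [Ensemble], so that the elimination can recurse over it. Signs are
    forgotten: an upper bound on the signed atoms is enough. *)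
Fixpoint atoms {Atom : Type} (phi : form Atom) : list Atom :=
  match phi with
  | Var p => [p]
  | Bot => []
  | And a b | Or a b | Imp a b => atoms a ++ atoms b
  | Box a => atoms a
  end.

Lemma Vs_atoms (Atom : Type) (phi : form Atom) (o : sign) (p : Atom) :
  Ensembles.In _ (Vs o phi) p -> List.In p (atoms phi).
Proof.
  revert o; induction phi as [q| |a IHa b IHb|a IHa b IHb|a IHa b IHb|a IHa];
    intros o H; simpl in *.
  - destruct o; destruct H; now left.
  - destruct H.
  - apply in_or_app; destruct H; eauto.
  - apply in_or_app; destruct H; eauto.
  - apply in_or_app; destruct H; eauto.
  - eauto.
Qed.

Lemma V_Vs (Atom : Type) (phi : form Atom) (p : Atom) :
  Ensembles.In _ (V phi) p <-> exists o, Ensembles.In _ (Vs o phi) p.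
Proof.
  split.
  - intros [q H|q H]; eauto.
  - intros [[|] H]; [now left|now right].
Qed.

Lemma free_sfree (Atom : Type) (p : Atom) (phi : form Atom) :
  free p phi <-> forall o, sfree o p phi.
Proof. unfold free, sfree; rewrite V_Vs; firstorder. Qed.

Lemma Included_V (Atom : Type) (phi psi : form Atom) :
  (forall d, Included _ (Vs d phi) (Vs d psi)) -> Included _ (V phi) (V psi).
Proof.
  intros H p Hp; apply V_Vs in Hp as [o Hp]; apply V_Vs.
  exists o; now apply H.
Qed.

(** Induction on [s], from its tail to its head. Pairs that occur in [psi] may be listed too; they
    are skipped, so that [psi] remains a consequence throughout. *)
Lemma ULIP_eliminate (Atom : Type) (L : Ensemble (form Atom))
  (hL : is_logic L) (HU : ULIP L) (phi psi : form Atom)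
  (s : list (Atom * sign)) :
  L ⊢ Imp phi psi ->
  exists theta : form Atom,
    (forall d, Included _ (Vs d theta) (Vs d phi)) /\
    (forall p o, List.In (p, o) s -> sfree o p psi -> sfree o p theta) /\
    L ⊢ Imp phi theta /\ L ⊢ Imp theta psi.
Proof.
  intros Himp; induction s as [|[q o] s IH].
  - exists phi; repeat split; auto using logic_refl.
    + now intros d p.
    + contradiction.
  - destruct IH as (theta & Hsub & Hfree & Hpt & Htp).
    (* Excluded middle, because equality on [Atom] is not assumed decidable. *)
    destruct (Classical_Prop.classic (sfree o q psi)) as [Hq|Hq].
    + destruct (HU theta q o)
        as (ex & _ & Hex & _ & Hexsub & _ & Htex & Hexmin & _).
      exists ex; repeat split.
      * intros d p Hp; now apply Hsub, Hexsub.
      * intros p o' [E|Hin] Hp.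
        -- now injection E as <- <-.
        (* The new quantifier adds no signed atoms, so those eliminated before stay away. *)
        -- intros Hc; apply (Hfree p o' Hin Hp); now apply Hexsub.
      * now apply logic_trans with theta.
      * now apply Hexmin.
    + exists theta; repeat split; auto.
      intros p o' [E|Hin] Hp; [|now apply Hfree].
      now injection E as <- <-.
Qed.

Lemma ULIP_LIP (Atom : Type) (L : Ensemble (form Atom)) (hL : is_logic L) :
  ULIP L -> LIP L.
Proof.
  intros HU phi psi Himp.
  (* Pairing each atom with both signs covers every signed atom of [phi], hence of [theta]. *)
  destruct (ULIP_eliminate _ _ hL HU phi psi
              (list_prod (atoms phi) [Pos; Neg]) Himp)
    as (theta & Hsub & Hfree & Hpt & Htp).
  exists theta; repeat split; auto.
  - now apply Hsub.
  (* A signed atom of [theta] missing from [psi] would have been eliminated. *)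
  - apply Classical_Prop.NNPP; intros Hn.
    apply (Hfree x d) with (2 := Hn); [|assumption].
    apply in_prod.
    + now apply Vs_atoms with d, Hsub.
    + destruct d; simpl; tauto.
Qed.

Lemma ULIP_UIP (Atom : Type) (L : Ensemble (form Atom)) (hL : is_logic L) :
  ULIP L -> UIP L.
Proof.
  intros HU phi p.
  destruct (HU phi p Pos)
    as (e1 & a1 & He1 & Ha1 & Hes1 & Has1 & Hpe1 & Hem1 & Hap1 & Ham1).
  destruct (HU e1 p Neg)
    as (e2 & _ & He2 & _ & Hes2 & _ & Hpe2 & Hem2 & _).
  destruct (HU a1 p Neg)
    as (_ & a2 & _ & Ha2 & _ & Has2 & _ & _ & Hap2 & Ham2).
  exists e2, a2; repeat split.
  (* Eliminating negative [p] cannot bring back positive [p], as [e2] has only signed atoms of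
     [e1]. *)
  - apply free_sfree; intros [|]; [|assumption].
    intros Hc; now apply He1, Hes2.
  - apply free_sfree; intros [|]; [|assumption].
    intros Hc; now apply Ha1, Has2.
  - apply Included_V; intros d q Hq; now apply Hes1, Hes2.
  - apply Included_V; intros d q Hq; now apply Has1, Has2.
  - now apply logic_trans with e1.
  (* As [psi] lacks [p] in both signs, [Hem1] gives [e1 ⟶ psi] and then [Hem2] gives [e2 ⟶ psi]. *)
  - intros psi Hpsi Himp; rewrite free_sfree in Hpsi; auto.
  - now apply logic_trans with a1.
  - intros psi Hpsi Himp; rewrite free_sfree in Hpsi; auto.
Qed.

Theorem theorem2p5 (Atom : Type) (L : Ensemble (form Atom)) (hL : is_logic L) :
  ULIP L -> LIP L /\ UIP L.
Proof. intros HU; split; [now apply ULIP_LIP|now apply ULIP_UIP]. Qed.
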